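(* Let $R$ be an associative ring with identity, $M$ a right $R$-module, $S=\mathrm{End}_R(M)$, and let $m_1,m_2\in M$ with $m_1$ regular. Then $m_1\leq^{-}m_2$ if and only if there exist $f^2=f\in S$ and $a^2=a\in R$ such that $l_S(m_1)=l_S(f)$, $r_R(m_1)=r_R(a)$, $fm_1=fm_2$, and $m_1a=m_2a$.
   Context: Rings are associative with identity, and modules are unitary right modules. For a right $R$-module $M$, let $S=\mathrm{End}_R(M)$ (so $M$ is an $(S,R)$-bimodule) and $M^*=\mathrm{Hom}_R(M,R)$. For $m\in M$ and $\varphi\in M^*$, write $\varphi m:=\varphi(m)\in R$, and let $m\varphi\in S$ denote the endomorphism $x\mapsto m\,\varphi(x)$ of $M$. An element $m\in M$ is (Zelmanowitz) regular if $m=m\varphi m$, i.e. $m=m\,\varphi(m)$, for some $\varphi\in M^*$. Minus order: for $m_1,m_2\in M$, $m_1\leq^{-}m_2$ means that there exists $\varphi\in M^*$ such that $m_1=m_1\varphi m_1$, $m_1\varphi=m_2\varphi$ (in $S$), and $\varphi m_1=\varphi m_2$ (in $R$). Annihilators: $l_S(m)=\{g\in S: gm=0\}$ and $r_R(m)=\{r\in R: mr=0\}$ for $m\in M$; $l_S(f)=\{g\in S: gf=0\}$ for $f\in S$; $r_R(a)=\{r\in R: ar=0\}$ for $a\in R$. *)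

(* Defs.v *)
From HB Require Import structures.
From mathcomp Require Import all_boot all_algebra.

Set Implicit Arguments.
Unset Strict Implicit.
Unset Printing Implicit Defensive.

Import GRing.Theory.
Local Open Scope ring_scope.

(* MathComp has only left modules: a right module over R is encoded as a left
   module over the converse ring R^c, whose product is x, y |-> y * x in R, so
   that (m <* r) <* s = m <* (r * s). *)
Definition raction (R : pzRingType) (M : lmodType R^c) (m : M) (r : R) : M :=
  (r : R^c) *: m.

Notation "m <* r" := (raction m r) (at level 40, left associativity).

Lemma ractionA (R : pzRingType) (M : lmodType R^c) (m : M) (r s : R) :
  m <* r <* s = m <* (r * s).
Proof. exact: scalerA. Qed.

(* Equality of endomorphisms is always taken pointwise, as { linear _ -> _ } is
   not extensional without axioms. *)
Definition rEnd (R : pzRingType) (M : lmodType R^c) : Type := {linear M -> M}.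

(* (R^c)^o is R as a right module over itself: scaling x by r gives x * r. *)
Definition rDual (R : pzRingType) (M : lmodType R^c) : Type :=
  {linear M -> (R^c)^o}.

Definition rpair (R : pzRingType) (M : lmodType R^c) (phi : rDual M) (m : M)
  : R := phi m.

Lemma rpairM (R : pzRingType) (M : lmodType R^c) (phi : rDual M) (m : M)
  (r : R) : rpair phi (m <* r) = rpair phi m * r.
Proof. exact: (linearZZ phi). Qed.

Definition rank1_fun (R : pzRingType) (M : lmodType R^c) (m : M)
  (phi : rDual M) (x : M) : M := m <* rpair phi x.

Lemma rank1_fun_linear (R : pzRingType) (M : lmodType R^c) (m : M)
  (phi : rDual M) : linear (rank1_fun m phi).
Proof.
move=> r x y; rewrite /rank1_fun /rpair /raction.
by rewrite linearP scalerDl -scalerA.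
Qed.

HB.instance Definition _ (R : pzRingType) (M : lmodType R^c) (m : M)
  (phi : rDual M) :=
  GRing.isLinear.Build R^c M M *:%R (rank1_fun m phi) (rank1_fun_linear m phi).

Definition rank1 (R : pzRingType) (M : lmodType R^c) (m : M) (phi : rDual M)
  : rEnd M := rank1_fun m phi.

Definition zregular (R : pzRingType) (M : lmodType R^c) (m : M) : Prop :=
  exists phi : rDual M, m = m <* rpair phi m.

Definition minus_le (R : pzRingType) (M : lmodType R^c) (m1 m2 : M) : Prop :=
  exists phi : rDual M,
    [/\ m1 = m1 <* rpair phi m1,
        rank1 m1 phi =1 rank1 m2 phi
      & rpair phi m1 = rpair phi m2].

Definition lann_elt (R : pzRingType) (M : lmodType R^c) (m : M) (g : rEnd M)
  : Prop := g m = 0.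

Definition lann_end (R : pzRingType) (M : lmodType R^c) (f g : rEnd M) : Prop :=
  g \o f =1 (fun=> 0).

Definition rann_elt (R : pzRingType) (M : lmodType R^c) (m : M) (r : R)
  : Prop := m <* r = 0.

Definition rann_ring (R : pzRingType) (a r : R) : Prop := a * r = 0.

(* Main.v *)
(** If [phi] witnesses [minus_le m1 m2], take [f = m1 phi] and [a = phi m1].
    Conversely, testing the two annihilator equalities on [1 - f] and [1 - a]
    gives [f m1 = m1] and [m1 a = m1]; if [m1 = m1 psi m1], then
    [phi = a psi f] witnesses [minus_le m1 m2]. *)
Require Import Defs.
From HB Require Import structures.
From mathcomp Require Import all_boot all_algebra.

Import GRing.Theory.
Local Open Scope ring_scope.

(** The element [a psi f] of $M^*$, for $M^*$ seen as an $(R,S)$-bimodule; the product is taken in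
    [R], not in [R^c]. *)
Definition dual_comp_fun (R : pzRingType) (M : lmodType R^c) (a : R)
  (psi : rDual M) (f : rEnd M) (x : M) : (R^c)^o := a * rpair psi (f x).

Lemma dual_comp_fun_linear (R : pzRingType) (M : lmodType R^c) (a : R)
  (psi : rDual M) (f : rEnd M) : linear (dual_comp_fun R M a psi f).
Proof.
move=> r x y; rewrite /dual_comp_fun /rpair !linearP.
rewrite [LHS](mulrDr a); congr (_ + _).
(* Scaling by [r] in [(R^c)^o] unfolds to right multiplication by [r] in [R], so it commutes with
   left multiplication by [a]. *)
exact: (mulrA a (psi (f x) : R) r).
Qed.

HB.instance Definition _ (R : pzRingType) (M : lmodType R^c) (a : R)
  (psi : rDual M) (f : rEnd M) :=
  GRing.isLinear.Build R^c M (R^c)^o *:%R (dual_comp_fun R M a psi f)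
    (dual_comp_fun_linear R M a psi f).

Definition dual_comp (R : pzRingType) (M : lmodType R^c) (a : R)
  (psi : rDual M) (f : rEnd M) : rDual M := dual_comp_fun R M a psi f.

Lemma end_raction (R : pzRingType) (M : lmodType R^c) (g : rEnd M) (m : M)
  (r : R) : g (m <* r) = g m <* r.
Proof. exact: (linearZZ g). Qed.

Lemma raction0l (R : pzRingType) (M : lmodType R^c) (r : R) :
  (0 : M) <* r = 0.
Proof. exact: scaler0. Qed.

Lemma raction0r (R : pzRingType) (M : lmodType R^c) (m : M) : m <* 0 = 0.
Proof. exact: scale0r. Qed.

Lemma ractionB1 (R : pzRingType) (M : lmodType R^c) (m : M) (r : R) :
  m <* (1 - r) = m - m <* r.
Proof. by rewrite /raction [LHS]scalerBl scale1r. Qed.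

(** Idempotence gives $(1-f)f=0$, so $1-f$ must also kill [m]. *)
Lemma lann_idem_fix (R : pzRingType) (M : lmodType R^c) (m : M) (f : rEnd M) :
  f \o f =1 f -> (forall g : rEnd M, lann_elt m g <-> lann_end f g) -> f m = m.
Proof.
move=> ff lf; pose g : rEnd M := idfun \- f.
have /(lf g) : lann_end f g by move=> x; rewrite /= -[f (f x)]/((f \o f) x) ff subrr.
by rewrite /lann_elt /= => /eqP; rewrite subr_eq0 => /eqP.
Qed.

Lemma rann_idem_fix (R : pzRingType) (M : lmodType R^c) (m : M) (a : R) :
  a * a = a -> (forall r : R, rann_elt m r <-> rann_ring a r) -> m <* a = m.
Proof.
move=> aa ra; have /ra : rann_ring a (1 - a) by rewrite /rann_ring mulrBr mulr1 aa subrr.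
by rewrite /rann_elt ractionB1 => /eqP; rewrite subr_eq0 => /eqP.
Qed.

Theorem theorem2p5 (R : pzRingType) (M : lmodType R^c) (m1 m2 : M)
  (m1_reg : zregular m1) :
  minus_le m1 m2 <->
  exists (f : rEnd M) (a : R),
    [/\ f \o f =1 f, a * a = a
      & [/\ forall g : rEnd M, lann_elt m1 g <-> lann_end f g,
            forall r : R, rann_elt m1 r <-> rann_ring a r,
            f m1 = f m2
          & m1 <* a = m2 <* a]].
Proof.
split=> [[phi [m1E m12 phi12]] | [f [a [ff aa [lf ra f12 a12]]]]].
  exists (rank1 m1 phi), (rpair phi m1); split; last split.
  - by move=> x; rewrite /= /rank1_fun rpairM -ractionA -m1E.
  - by rewrite -rpairM -m1E.
  - move=> g; split=> [gm x | gf].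
      by rewrite /= /rank1_fun end_raction gm raction0l.
    (* Since $m_1=(m_1\varphi)(m_1)$, evaluating $g\,(m_1\varphi)=0$ at [m1] gives $g m_1=0$. *)
    by rewrite /lann_elt m1E; apply: (gf m1).
  - move=> r; split=> [m1r | ar].
      by rewrite /rann_ring -rpairM m1r /rpair linear0.
    by rewrite /rann_elt m1E ractionA ar raction0r.
  - by rewrite /= /rank1_fun phi12.
  (* This is $m_1\varphi=m_2\varphi$ evaluated at [m1]. *)
  - exact: m12.
case: m1_reg => psi m1E.
have fm1 := lann_idem_fix _ _ _ _ ff lf.
have m1a := rann_idem_fix _ _ _ _ aa ra.
(* Each factor serves one condition: [psi] between the fixing factors keeps $m_1\varphi m_1=m_1$,
   [a] on the left turns $m_1a=m_2a$ into $m_1\varphi=m_2\varphi$, and [f] on the right turns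
   $fm_1=fm_2$ into $\varphi m_1=\varphi m_2$. *)
exists (dual_comp R M a psi f); split.
- by rewrite /rpair /= /dual_comp_fun fm1 -ractionA m1a.
- by move=> x; rewrite /= /rank1_fun /rpair /= /dual_comp_fun -!ractionA a12.
- by rewrite /rpair /= /dual_comp_fun f12.
Qed.
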